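(* A graph $G$ has the property that $\gamma_R(H)=\frac{3}{2}\gamma_{r2}(H)$ for every induced subgraph $H$ of $G$ with $\gamma_{r2}(H)\geq 3$ if and only if $G$ is $\{\bar{K}_3, K_2\cup K_1\}$-free.
   Context: All graphs are finite, simple and undirected. A $2$-rainbow dominating function of a graph $G$ is a function $f:V(G)\to 2^{\{1,2\}}$ such that $\bigcup_{v\in N_G(u)} f(v)=\{1,2\}$ for every vertex $u$ with $f(u)=\emptyset$; its weight is $\sum_{u\in V(G)}|f(u)|$, and $\gamma_{r2}(G)$ is the minimum weight of a $2$-rainbow dominating function of $G$. A Roman dominating function of $G$ is a function $g:V(G)\to\{0,1,2\}$ such that every vertex $u$ with $g(u)=0$ has a neighbor $v$ with $g(v)=2$; its weight is $\sum_{u\in V(G)} g(u)$, and $\gamma_R(G)$ is the minimum weight of a Roman dominating function of $G$. $\bar{K}_3$ is the edgeless graph on $3$ vertices and $K_2\cup K_1$ is the disjoint union of an edge and an isolated vertex; $G$ is $\{\bar{K}_3, K_2\cup K_1\}$-free if it has no induced subgraph isomorphic to either of these graphs. *)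

(* Defs.v *)
(* MathComp *)
From HB Require Import structures.
From mathcomp Require Import all_boot all_order all_algebra.
Set Implicit Arguments.
Unset Strict Implicit.
Unset Printing Implicit Defensive.

Record sgraph := SGraph {
  vertex :> finType;
  edge : rel vertex;
  edge_sym : symmetric edge;
  edge_irrefl : irreflexive edge }.

Definition neigh (G : sgraph) (u : G) : {set G} := [set v | edge u v].

Section InducedSubgraph.
Variables (G : sgraph) (S : {set G}).

Definition induced_edge : rel {x : G | x \in S} :=
  fun x y => edge (val x) (val y).

Fact induced_edge_sym : symmetric induced_edge.
Proof. by move=> x y; apply: edge_sym. Qed.

Fact induced_edge_irrefl : irreflexive induced_edge.
Proof. by move=> x; apply: edge_irrefl. Qed.

Definition induced : sgraph := SGraph induced_edge_sym induced_edge_irrefl.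
End InducedSubgraph.

Definition isomorphic (G H : sgraph) : Prop :=
  exists2 h : G -> H, bijective h & {mono h : x y / edge x y}.

Definition induced_free (F G : sgraph) : Prop :=
  ~ exists S : {set G}, isomorphic (induced S) F.

Section Complete.
Variable n : nat.

Definition complete_edge : rel 'I_n := fun x y => x != y.

Fact complete_edge_sym : symmetric complete_edge.
Proof. by move=> x y; rewrite /complete_edge eq_sym. Qed.

Fact complete_edge_irrefl : irreflexive complete_edge.
Proof. by move=> x; rewrite /complete_edge eqxx. Qed.

Definition complete : sgraph := SGraph complete_edge_sym complete_edge_irrefl.
End Complete.

Section Edgeless.
Variable n : nat.

Definition edgeless_edge : rel 'I_n := fun _ _ => false.

Fact edgeless_edge_sym : symmetric edgeless_edge.
Proof. by []. Qed.

Fact edgeless_edge_irrefl : irreflexive edgeless_edge.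
Proof. by []. Qed.

Definition edgeless : sgraph := SGraph edgeless_edge_sym edgeless_edge_irrefl.
End Edgeless.

Section DisjointUnion.
Variables G H : sgraph.

Definition disjoint_edge : rel (G + H)%type := fun x y =>
  match x, y with
  | inl a, inl b => edge a b
  | inr a, inr b => edge a b
  | _, _ => false
  end.

Fact disjoint_edge_sym : symmetric disjoint_edge.
Proof. by move=> [a|a] [b|b] //=; apply: edge_sym. Qed.

Fact disjoint_edge_irrefl : irreflexive disjoint_edge.
Proof. by move=> [a|a] /=; apply: edge_irrefl. Qed.

Definition disjoint_union : sgraph :=
  SGraph disjoint_edge_sym disjoint_edge_irrefl.
End DisjointUnion.

Section Domination.
Variable G : sgraph.

(* The colours 1 and 2 are the two elements of 'I_2. *)
Definition rainbow2_dominating (f : {ffun G -> {set 'I_2}}) : bool :=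
  [forall u, (f u == set0) ==> (\bigcup_(v in neigh u) f v == setT)].

Definition rainbow2_weight (f : {ffun G -> {set 'I_2}}) : nat :=
  \sum_(u : G) #|f u|.

(* Every function without empty values is 2-rainbow dominating, so the search
   below ranges over a nonempty set (see rainbow2_numberP). *)
Definition rainbow2_full : {ffun G -> {set 'I_2}} := [ffun=> setT].

Definition rainbow2_number : nat :=
  rainbow2_weight
    [arg min_(f < rainbow2_full | rainbow2_dominating f) rainbow2_weight f].

Fact rainbow2_numberP :
  (exists2 f, rainbow2_dominating f & rainbow2_weight f = rainbow2_number) /\
  (forall f, rainbow2_dominating f -> rainbow2_number <= rainbow2_weight f).
Proof.
rewrite /rainbow2_number; case: arg_minnP => [|f fP fmin].
  apply/forallP => u; rewrite ffunE; apply/implyP => /eqP/setP/(_ ord0).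
  by rewrite !inE.
by split=> //; exists f.
Qed.

Definition roman_dominating (g : {ffun G -> 'I_3}) : bool :=
  [forall u, (g u == 0 :> nat) ==> [exists v in neigh u, g v == 2 :> nat]].

Definition roman_weight (g : {ffun G -> 'I_3}) : nat := \sum_(u : G) g u.

Definition roman_full : {ffun G -> 'I_3} := [ffun=> ord_max].

Definition roman_number : nat :=
  roman_weight [arg min_(g < roman_full | roman_dominating g) roman_weight g].

Fact roman_numberP :
  (exists2 g, roman_dominating g & roman_weight g = roman_number) /\
  (forall g, roman_dominating g -> roman_number <= roman_weight g).
Proof.
rewrite /roman_number; case: arg_minnP => [|g gP gmin].
  by apply/forallP => u; rewrite ffunE.
by split=> //; exists g.
Qed.
End Domination.

(* Main.v *)
(** Being {K3-bar, K2 + K1}-free means that in the complement of the graph every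
    vertex has degree at most 1.  In such a graph, and hence in all its induced
    subgraphs, a vertex together with its unique non-neighbour (or a universal
    vertex alone) carries a 2-rainbow dominating function of weight 2, so the
    hypothesis [3 <= gamma_r2] is never met.  Conversely, both forbidden graphs
    have maximum degree at most 1, so their 2-rainbow domination number is their
    order 3, and [2 * gamma_R = 9] is impossible by parity. *)
Require Import Defs.
From mathcomp Require Import all_boot all_order all_algebra.
Set Implicit Arguments.
Unset Strict Implicit.
Unset Printing Implicit Defensive.

(** Lets an induced copy of [F] be given by a map out of [F]. The inverse demanded by [isomorphic]
    exists because the corestriction of [k] to its image is injective between sets of equal size. *)
Lemma isomorphic_induced_imset (F G : sgraph) (k : F -> G) :
  injective k -> {mono k : x y / edge x y} ->
  isomorphic (induced [set k x | x in F]) F.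
Proof.
move=> k_inj k_mono.
pose k' (x : F) : induced [set k x | x in F] :=
  exist _ (k x) (imset_f k (isT : x \in F)).
have k'_inj : injective k' by move=> x y /(congr1 val)/k_inj.
have [|h hK k'K] := inj_card_bij k'_inj; first by rewrite card_sig card_imset.
exists h; first by exists k'.
by move=> x y; rewrite -k_mono -[x in RHS]k'K -[y in RHS]k'K.
Qed.

Definition degree_le1 (G : sgraph) : Prop :=
  forall u v w : G, edge u v -> edge u w -> v = w.

Lemma degree_le1_isomorphic (F G : sgraph) :
  isomorphic G F -> degree_le1 F -> degree_le1 G.
Proof.
move=> [h /bij_inj h_inj h_mono] F1 u v w uv uw.
by apply: h_inj; apply: (F1 (h u)); rewrite h_mono.
Qed.

Lemma degree_le1_edgeless (n : nat) : degree_le1 (edgeless n).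
Proof. by []. Qed.

Lemma degree_le1_K2K1 : degree_le1 (disjoint_union (complete 2) (complete 1)).
Proof.
move=> [u|u] [v|v] [w|w] //; last by rewrite /= /complete_edge (ord1 u) (ord1 v).
rewrite /= /complete_edge => uv uw; congr inl; apply/val_inj; move: uv uw.
by case: u v w => [[|[|]]] // ? [[|[|]]] // ? [[|[|]]].
Qed.

(* A vertex of value set0 has a single neighbour, which must have value setT;
   sharing the weight 2 of that neighbour gives every vertex weight 1. *)
Lemma card_le_rainbow2_weight (G : sgraph) (f : {ffun G -> {set 'I_2}}) :
  degree_le1 G -> rainbow2_dominating f -> #|G| <= rainbow2_weight f.
Proof.
move=> G1 /forallP fdom.
pose Z := [set u | f u == set0]; pose T := [set u | f u == setT].
(* The default [u] is taken only at isolated vertices. None of them lies in [Z], since a union over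
   no neighbours is empty. *)
pose p (u : G) : G := odflt u [pick v | edge u v].
have pZ u : u \in Z -> edge u (p u) && (p u \in T).
  rewrite inE => fu0; have := fdom u; rewrite fu0 /= /p.
  case: pickP => [v uv|u_isol] /=.
    rewrite (_ : neigh u = [set v]) ?big_set1 ?uv ?inE //.
    apply/setP => w; rewrite !inE; apply/idP/eqP => [uw|->//].
    exact: G1 uw uv.
  rewrite big_pred0 => [|v]; last by rewrite inE u_isol.
  by move/eqP/setP/(_ ord0); rewrite !inE.
have leZT : #|Z| <= #|T|.
  (* [p] is injective on [Z]: if two vertices share the image [p u], both are neighbours of it,
     hence equal. *)
  rewrite -(@card_in_imset _ _ p) => [|u v /pZ/andP[uv _] /pZ/andP[uw _] eqp].
    by apply/subset_leq_card/subsetP => _ /imsetP[u /pZ/andP[_ ?] ->].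
  by apply: (G1 (p u)); [|rewrite eqp]; rewrite edge_sym.
(* With two colours, the size is 1 for being nonempty plus 1 for being full. *)
have weightE u : #|f u| = (u \in ~: Z) + (u \in T).
  rewrite !inE; have := max_card (f u); rewrite card_ord -cards_eq0 eqEcard subsetT.
  by rewrite cardsT card_ord /=; case: #|f u| => [|[|[]]].
rewrite /rainbow2_weight (eq_bigr _ (fun u _ => weightE u)) big_split /=.
rewrite -!big_mkcond /= !sum1_card -(cardsC Z) addnC.
by rewrite leq_add2l.
Qed.

Lemma rainbow2_number_le_card (G : sgraph) : rainbow2_number G <= #|G|.
Proof.
have [_ /(_ [ffun=> [set ord0]])] := rainbow2_numberP G.
rewrite /rainbow2_weight; under eq_bigr => u _ do rewrite ffunE cards1.
rewrite sum1_card; apply; apply/forallP => u; rewrite ffunE; apply/implyP.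
by rewrite -cards_eq0 cards1.
Qed.

Lemma rainbow2_number_degree_le1 (G : sgraph) :
  degree_le1 G -> rainbow2_number G = #|G|.
Proof.
move=> G1; apply/eqP; rewrite eqn_leq rainbow2_number_le_card /=.
by have [[f fdom <-] _] := rainbow2_numberP G; apply: card_le_rainbow2_weight.
Qed.

(** The inequalities exclude [u] itself, which is never its own neighbour. *)
Definition codegree_le1 (G : sgraph) : Prop :=
  forall u v w : G, u != v -> u != w -> ~~ edge u v -> ~~ edge u w -> v = w.

Lemma codegree_le1_induced (G : sgraph) (S : {set G}) :
  codegree_le1 G -> codegree_le1 (induced S).
Proof.
by move=> G1 u v w uv uw nuv nuw; apply: val_inj; apply: (G1 (val u)).
Qed.

(** Two distinct non-neighbours [v], [w] of [u] would induce, together with [u], one of the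
    forbidden graphs; which one depends on whether [v] and [w] are adjacent. *)
Lemma codegree_le1_induced_free (G : sgraph) :
  induced_free (edgeless 3) G ->
  induced_free (disjoint_union (complete 2) (complete 1)) G ->
  codegree_le1 G.
Proof.
move=> noK3bar noK2K1 u v w uv uw nuv nuw; apply/eqP/negPn/negP => vw.
have [e_vw|ne_vw] := boolP (edge v w).
  apply: noK2K1.
  pose k (x : disjoint_union (complete 2) (complete 1)) : G :=
    match x with inl i => if i == ord0 then v else w | inr _ => u end.
  exists [set k x | x in disjoint_union (complete 2) (complete 1)].
  apply: isomorphic_induced_imset.
    move=> [[[|[|//]] ?]|i] [[[|[|//]] ?]|j] /= kxy;
      by [congr inl; apply: val_inj | rewrite (ord1 i) (ord1 j)
         | move: uv uw vw; rewrite kxy eqxx].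
  move=> [[[|[|//]] ?]|i] [[[|[|//]] ?]|j] /=;
    rewrite ?edge_irrefl ?(edge_sym w v) ?(edge_sym _ u) ?e_vw
      ?(negPf nuv) ?(negPf nuw) //.
  by rewrite (ord1 i) (ord1 j).
apply: noK3bar; pose k (i : edgeless 3) : G := tnth [tuple u; v; w] i.
exists [set k i | i in edgeless 3]; apply: isomorphic_induced_imset.
  by apply/tuple_uniqP; rewrite /= !inE negb_or uv uw vw.
move=> [[|[|[|//]]] ?] [[|[|[|//]]] ?];
  rewrite /k !(tnth_nth u) /= ?edge_irrefl //;
  by rewrite ?(edge_sym w v) ?(edge_sym _ u)
    ?(negPf nuv) ?(negPf nuw) ?(negPf ne_vw).
Qed.

Lemma rainbow2_number_codegree_le1 (G : sgraph) :
  codegree_le1 G -> rainbow2_number G <= 2.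
Proof.
move=> G1; have [_ fmin] := rainbow2_numberP G.
have [u _|G0] := pickP (fun _ : G => true); last first.
  by apply: leq_trans (rainbow2_number_le_card G) _; rewrite eq_card0.
have [v /andP[uv nuv]|u_univ] := pickP (fun v => (u != v) && ~~ edge u v).
  (* Each of [u], [v] receives one colour. Both are adjacent to every other vertex, being each
     other's only non-neighbour. *)
  pose f : {ffun G -> {set 'I_2}} := [ffun x =>
    if x == u then [set ord0] else if x == v then [set ord_max] else set0].
  have fdom : rainbow2_dominating f.
    apply/forallP => w; apply/implyP; rewrite ffunE.
    case: (eqVneq w u) => [_|wu]; first by rewrite -cards_eq0 cards1.
    case: (eqVneq w v) => [_|wv]; first by rewrite -cards_eq0 cards1.
    move=> _; have uw : edge u w.
      apply: contraNT wv => nuw; apply/eqP/(G1 u); by rewrite // eq_sym.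
    have vw : edge v w.
      apply: contraNT wu => nvw; apply/eqP/(G1 v); by rewrite // 1?eq_sym // edge_sym.
    rewrite -subTset; apply/subsetP => i _; apply/bigcupP.
    case: (eqVneq i ord0) => [->|i0].
      by exists u; rewrite ?inE 1?edge_sym // ffunE eqxx inE.
    exists v; first by rewrite inE edge_sym.
    rewrite ffunE eq_sym (negPf uv) eqxx inE.
    by case: i i0 => [[|[|]]].
  apply: leq_trans (fmin f fdom) _.
  rewrite /rainbow2_weight (bigD1 u) //= (bigD1 v) 1?eq_sym //= big1.
    by rewrite !ffunE eqxx eq_sym (negPf uv) eqxx !cards1.
  by move=> w /andP[wu wv]; rewrite ffunE (negPf wu) (negPf wv) cards0.
(* Here [u] is adjacent to all other vertices, so it can supply both colours alone. *)
pose f : {ffun G -> {set 'I_2}} := [ffun x => if x == u then setT else set0].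
have fdom : rainbow2_dominating f.
  apply/forallP => w; apply/implyP; rewrite ffunE.
  case: (eqVneq w u) => [_|wu _]; first by rewrite -cards_eq0 cardsT card_ord.
  rewrite -subTset; apply: (bigcup_max u); last by rewrite ffunE eqxx.
  by have := u_univ w; rewrite inE edge_sym eq_sym wu => /negbFE.
apply: leq_trans (fmin f fdom) _.
rewrite /rainbow2_weight (bigD1 u) //= big1.
  by rewrite ffunE eqxx cardsT card_ord.
by move=> w wu; rewrite ffunE (negPf wu) cards0.
Qed.

Lemma three_halves_of_three (n : nat) :
  (n%:R = 3%:R / 2%:R * 3%:R :> rat)%R -> False.
Proof.
(* Doubling clears the denominator, giving an equality of naturals whose right side is odd. *)
move=> n_eq; have : ((n * 2)%:R = 9%:R :> rat)%R.
  by rewrite GRing.natrM n_eq.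
by move/eqP; rewrite Num.Theory.eqr_nat => /eqP/(congr1 odd); rewrite oddM andbF.
Qed.

(** An induced copy of [F] would itself violate the assumed identity: its 2-rainbow domination
    number is its order 3. *)
Lemma induced_free_of_three_halves (F G : sgraph) :
  degree_le1 F -> #|F| = 3 ->
  (forall S : {set G},
     (3 <= rainbow2_number (induced S))%N ->
     ((roman_number (induced S))%:R =
       3%:R / 2%:R * (rainbow2_number (induced S))%:R :> rat)%R) ->
  induced_free F G.
Proof.
move=> F1 F3 GP [S SF].
have S3 : rainbow2_number (induced S) = 3.
  rewrite (rainbow2_number_degree_le1 (degree_le1_isomorphic SF F1)) -F3.
  by have [h /bij_eq_card] := SF.
by have := GP S; rewrite S3 => /(_ isT)/three_halves_of_three.
Qed.

Theorem theorem5 (G : sgraph) :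
  (forall S : {set G},
     (3 <= rainbow2_number (induced S))%N ->
     ((roman_number (induced S))%:R =
       3%:R / 2%:R * (rainbow2_number (induced S))%:R :> rat)%R)
  <->
  (induced_free (edgeless 3) G /\
   induced_free (disjoint_union (complete 2) (complete 1)) G).
Proof.
split=> [GP|[noK3bar noK2K1] S].
  split; apply: induced_free_of_three_halves GP.
  - exact: degree_le1_edgeless.
  - exact: card_ord.
  - exact: degree_le1_K2K1.
  - by rewrite card_sum !card_ord.
have G1 := codegree_le1_induced_free noK3bar noK2K1.
by rewrite ltnNge rainbow2_number_codegree_le1 //; apply: codegree_le1_induced.
Qed.
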